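(* When $\beta_c<\beta<\infty$, the Gibbs measure cannot be concentrated on the minimum, that is, $\mu_{k_N,\beta}\neq\delta_{(\tilde\sigma)_1}$.
   Context: $\beta_c:=\sqrt{2\log 2}$. For each $N$, $\{(\sigma)_i:1\le i\le 2^N\}$ is an enumeration of $\{-1,+1\}^N$ and $(X_i)_{1\le i\le 2^N}$ are i.i.d. standard Gaussian random variables, $X_i$ being attached to $(\sigma)_i$. The Gibbs measure of the random energy model is the random probability measure $\mu_{N,\beta}$ on $\{-1,+1\}^N$ giving $(\sigma)_i$ the weight $e^{-\beta\sqrt N X_i}/\sum_{l=1}^{2^N}e^{-\beta\sqrt N X_l}$. $X_{1,2^N}\le\cdots\le X_{2^N,2^N}$ are the order statistics of the $X_i$, and $(\tilde\sigma)_j$ denotes the configuration $(\sigma)_i$ for which $X_i=X_{j,2^N}$; thus $(\tilde\sigma)_1$ is the configuration of minimal energy, and $\delta_{(\tilde\sigma)_1}$ is the point mass at it. The integers $k_N$ satisfy $k_N\uparrow\infty$, $k_N/N\uparrow\infty$ and $(\log k_N)(\log N)/N\downarrow0$ as $N\to\infty$, and $\mu_{k_N,\beta}$ is the approximation of the Gibbs measure that keeps only the first $k_N$ terms: $$\mu_{k_N,\beta}(\Psi)=\frac{\sum_{k=1}^{k_N}\Psi((\tilde\sigma)_k)\exp\left(-\frac{\beta}{\beta_c}\sqrt{2\log 2^N}\,(X_{k,2^N}-X_{1,2^N})\right)}{\sum_{k=1}^{k_N}\exp\left(-\frac{\beta}{\beta_c}\sqrt{2\log 2^N}\,(X_{k,2^N}-X_{1,2^N})\right)},\qquad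 \Psi:\{-1,+1\}^N\to\mathbb R.$$ *)

(* Defs.v *)
From HB Require Import structures.
From mathcomp Require Export all_boot all_order all_algebra.
From mathcomp Require Export all_classical all_reals all_analysis.

Set Implicit Arguments.
Unset Strict Implicit.
Unset Printing Implicit Defensive.

Import Order.TTheory GRing.Theory Num.Theory.
Import numFieldNormedType.Exports.

Local Open Scope classical_set_scope.
Local Open Scope ring_scope.

(* the two-point type {-1, +1} *)
Definition spin : finType := seq_sub [:: (-1 : int); 1].

Definition config (N : nat) : finType := {ffun 'I_N -> spin}.

Definition beta_c (R : realType) : R := Num.sqrt (2 * ln 2).

Definition mutually_independent (R : realType) (d : measure_display)
    (T : measurableType d) (P : probability T R) (I : finType)
    (X : I -> {RV P >-> R}) : Prop :=
  forall (J : {set I}) (A : I -> set R), (forall i, measurable (A i)) ->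
    (P (\bigcap_(i in [set i | i \in J]) (X i @^-1` A i)) =
     \prod_(i in J) P (X i @^-1` A i))%E.

Definition iid_std_gaussian (R : realType) (d : measure_display)
    (T : measurableType d) (P : probability T R) (I : finType)
    (X : I -> {RV P >-> R}) : Prop :=
  mutually_independent X /\
  forall (i : I) (A : set R), measurable A ->
    distribution P (X i) A = normal_prob (0 : R) (1 : R) A.

(* Ranks are counted from 0: the minimum has rank [first N] and the k-th
   smallest value has rank k - 1. *)
Lemma pow2_gt0 (N : nat) : (0 < 2 ^ N)%N.
Proof. by rewrite expn_gt0. Qed.

Definition first (N : nat) : 'I_(2 ^ N) := Ordinal (pow2_gt0 N).

(* The index carrying the value of rank k.  The sort is stable, so ties, which
   have probability 0, are resolved by the smaller index. *)
Definition rank_index (R : realType) (N : nat) (x : 'I_(2 ^ N) -> R)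
    (k : 'I_(2 ^ N)) : 'I_(2 ^ N) :=
  tnth [tuple of sort (fun i j => x i <= x j) (ord_tuple (2 ^ N))] k.

Definition order_stat (R : realType) (N : nat) (x : 'I_(2 ^ N) -> R)
    (k : 'I_(2 ^ N)) : R := x (rank_index x k).

Definition sorted_config (R : realType) (N : nat)
    (sigma : 'I_(2 ^ N) -> config N) (x : 'I_(2 ^ N) -> R)
    (k : 'I_(2 ^ N)) : config N := sigma (rank_index x k).

Definition trunc_weight (R : realType) (N : nat) (beta : R)
    (x : 'I_(2 ^ N) -> R) (k : 'I_(2 ^ N)) : R :=
  expR (- (beta / beta_c R * Num.sqrt (2 * ln (2 ^+ N))
           * (order_stat x k - order_stat x (first N)))).

(* Probability measures on the finite set [config N] are represented by their
   integration functionals.  There are only 2 ^ N ranks, so K > 2 ^ N has the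
   same effect as K = 2 ^ N. *)
Definition trunc_gibbs (R : realType) (N K : nat) (beta : R)
    (sigma : 'I_(2 ^ N) -> config N) (x : 'I_(2 ^ N) -> R)
    (Psi : config N -> R) : R :=
  (\sum_(k < 2 ^ N | (k < K)%N)
     Psi (sorted_config sigma x k) * trunc_weight beta x k)
  / (\sum_(k < 2 ^ N | (k < K)%N) trunc_weight beta x k).

Definition point_mass (R : realType) (N : nat) (s : config N)
    (Psi : config N -> R) : R := Psi s.

(* Main.v *)
Require Import Defs.
From mathcomp Require Import all_boot all_order all_algebra.
From mathcomp Require Import all_classical all_reals all_analysis.
From mathcomp Require Import measurable_realfun ring lra.

Set Implicit Arguments.
Unset Strict Implicit.
Unset Printing Implicit Defensive.

Import Order.TTheory GRing.Theory Num.Theory.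
Import numFieldNormedType.Exports.

Local Open Scope classical_set_scope.
Local Open Scope ring_scope.

(** The mass that the truncated Gibbs measure gives to the minimum is the
    inverse of the partition function, normalised so that the minimum has
    weight 1 ([min_massE]).  As soon as two terms are kept, the partition
    function exceeds 1, so the mass is below 1 for every realisation
    ([min_mass_lt1]) and the measure is never the point mass.

    For the quantitative part, only the second weight matters.  It equals
    exp (- beta * sqrt N * gap), where gap is the distance between the two
    smallest energies, so a mass close to 1 forces sqrt N * gap to be large
    ([gap_of_min_mass]).  It remains to see that sqrt N * gap is tight.  The
    minimum lies near - beta_c * sqrt N, where the Gaussian density grows at
    rate of order sqrt N; hence moving a minimum that is isolated by 3 L / sqrt N
    upwards, by 2 L / sqrt N, increases the probability by a factor
    exponential in L, and leaves it below all other points.  The events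
    obtained after moving are disjoint, so their total probability is at most
    1 and the original one is exponentially small in L.

    The move is carried out cell by cell ([prob_min_isolated_le]): below a
    level - s the line is cut into cells of length h, and the cell of the
    minimum is exchanged for the cell two steps higher, which is exp (s * h)
    times more likely ([normal_prob_cell_ratio]).  Only upper and lower bounds
    of the density on a cell are used, so no conditioning on the position of
    the minimum is needed.  With s = sqrt N / 2 and h = L / sqrt N the factor is
    exp (L / 2).  This s is far smaller than beta_c * sqrt N, which makes the
    remaining event, that no energy lies near or below - s, easy to exclude
    ([prob_all_gt_le], [normal_pdf_level_ge]). *)

(** * Bounds for the standard normal law *)

Lemma normal_pdf01E (R : realType) (x : R) :
  normal_pdf 0 1 x = normal_peak 1 * expR (- (x ^+ 2 / 2)).
Proof.
rewrite normal_pdfE ?oner_neq0// /normal_fun subr0 expr1n.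
by rewrite mulr2n mulNr.
Qed.

Lemma normal_pdf_nondecreasing_neg (R : realType) (x y : R) :
  x <= y -> y <= 0 -> normal_pdf 0 1 x <= normal_pdf 0 1 y.
Proof.
move=> xy y0; rewrite !normal_pdf01E ler_pM2l ?normal_peak_gt0 ?oner_neq0//.
rewrite ler_expR; nra.
Qed.

Lemma normal_prob_itv_bounds (R : realType) (a b : R) :
  a < b -> b <= 0 ->
  (((b - a) * normal_pdf 0 1 a)%:E <= normal_prob 0 1 `]a, b])%E /\
  (normal_prob 0 1 `]a, b] <= ((b - a) * normal_pdf 0 1 b)%:E)%E.
Proof.
move=> ab b0.
have cstE (r : R) : (\int[lebesgue_measure]_(x in `]a, b]) (cst r%:E) x)%E =
    ((b - a) * r)%:E.
  rewrite integral_cst// [X in (_ * X)%E](lebesgue_measure_itv `]a, b]%R)/=.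
  by rewrite lte_fin ab -EFinB -EFinM mulrC.
have mpdf : measurable_fun (`]a, b]%classic : set R) (normal_pdf (0 : R) 1).
  by apply: measurable_funTS; exact: measurable_normal_pdf.
rewrite /normal_prob; split; rewrite -cstE; apply: ge0_le_integral => //=.
- by move=> x _; rewrite lee_fin normal_pdf_ge0.
- exact/measurable_EFinP.
- move=> x; rewrite in_itv/= => /andP[ax xb].
  by rewrite lee_fin normal_pdf_nondecreasing_neg ?(ltW ax)// (le_trans xb).
- by move=> x _; rewrite lee_fin normal_pdf_ge0.
- exact/measurable_EFinP.
- move=> x; rewrite in_itv/= => /andP[ax xb].
  by rewrite lee_fin normal_pdf_nondecreasing_neg.
Qed.

(** The density is at most its value at [t - 2 * h] on the first cell and at
    least its value at [t - h] on the second.  The quotient of these two values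
    is [expR (h * (t - 3 / 2 * h))]; the empty cell between the two is what
    leaves room for this gain. *)
Lemma normal_prob_cell_ratio (R : realType) (s h t : R) :
  0 < h -> 0 <= s -> t <= - s ->
  (normal_prob 0 1 `](t - 3 * h)%R, (t - 2 * h)%R] <=
   (expR (- (s * h)))%:E * normal_prob 0 1 `](t - h)%R, t])%E.
Proof.
move=> h0 s0 ts.
have [||_ up] := @normal_prob_itv_bounds R (t - 3 * h) (t - 2 * h); [lra|lra|].
have [||lo _] := @normal_prob_itv_bounds R (t - h) t; [lra|lra|].
apply: (le_trans up).
have er : (0 <= (expR (- (s * h)) : R)%:E)%E by rewrite lee_fin expR_ge0.
apply: le_trans (lee_wpmul2l er lo).
rewrite -EFinM lee_fin !normal_pdf01E.
have -> : t - 2 * h - (t - 3 * h) = h by ring.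
have -> : t - (t - h) = h by ring.
rewrite [leRHS]mulrCA ler_pM2l// [leRHS]mulrCA ler_pM2l ?normal_peak_gt0 ?oner_neq0//.
rewrite -expRD ler_expR; nra.
Qed.

(** The half-line misses the unit interval just below it, where the density is
    least at the left end, and [1 - p <= expR (- p)]. *)
Lemma normal_prob_gt_le (R : realType) (c : R) : 0 <= c ->
  (normal_prob 0 1 `](- c)%R, +oo[ <=
   (expR (- normal_pdf 0 1 (- c - 1)))%:E)%E.
Proof.
move=> c0.
have [||lo _] := @normal_prob_itv_bounds R (- c - 1) (- c); [lra|lra|].
have mI : measurable (`]- c - 1, - c]%classic : set R) by exact: measurable_itv.
apply: (@le_trans _ _ (normal_prob 0 1 (~` `](- c - 1)%R, (- c)%R]))).
  apply: (@le_measure _ _ _ (normal_prob 0 1)); rewrite ?inE//.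
    exact: measurableC.
  by move=> y /=; rewrite !in_itv/= andbT => cy; apply/negP; rewrite (ltNge _ y) ?cy; lra.
rewrite (probability_setC (normal_prob 0 1))//.
apply: (@le_trans _ _ (1 - (normal_pdf 0 1 (- c - 1) : R)%:E)%E).
  apply: leeB => //; apply: le_trans lo; rewrite lee_fin.
  have -> : - c - (- c - 1) = 1 by ring.
  by rewrite mul1r.
by rewrite -EFinB lee_fin; exact: expR_ge1Dx.
Qed.

(** With [r = Num.sqrt N%:R], the exponent on the right is
    [N%:R * ln 2 - (r / 2 + 2) ^+ 2 / 2].  It grows linearly in [N] because
    [ln 2 >= 1 / 2] whereas [(r / 2) ^+ 2 / 2 = N%:R / 8]. *)
Lemma normal_pdf_level_ge (R : realType) (N : nat) :
  normal_peak (1 : R) * (N%:R / 4 - 3) <=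
  (2 ^ N)%:R * normal_pdf 0 1 (- (Num.sqrt N%:R / 2 + 2)).
Proof.
have ln2 : 1 / 2 <= ln 2 :> R.
  have := @le_ln1Dx R (- (1 / 2)).
  have -> : 1 + - (1 / 2) = 2^-1 :> R by field.
  rewrite lnV ?posrE//; lra.
rewrite normal_pdf01E sqrrN natrX mulrCA ler_pM2l ?normal_peak_gt0 ?oner_neq0//.
have -> : 2 ^+ N = expR (N%:R * ln 2) :> R by rewrite expRM_natl lnK ?posrE.
rewrite -expRD; apply: le_trans (expR_ge1Dx _).
set r := Num.sqrt _; have r2 : r ^+ 2 = N%:R by rewrite sqr_sqrtr.
have N2 : N%:R * (1 / 2) <= N%:R * ln 2 :> R by apply: ler_wpM2l.
have -> : (r / 2 + 2) ^+ 2 / 2 = N%:R / 8 + r + 2 by rewrite -r2; field.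
have := sqr_ge0 (r - 4); rewrite sqrrB r2; lra.
Qed.

(** * Isolated points of an independent normal sample *)

Section Independence.
Variables (R : realType) (d : measure_display) (T : measurableType d).
Variables (P : probability T R) (I : finType) (X : I -> {RV P >-> R}).
Implicit Types (A C : set R).

Definition one_and_others (i : I) A C : set T :=
  [set w | A (X i w) /\ forall j, j != i -> C (X j w)].

Lemma one_and_othersE i A C :
  one_and_others i A C =
  \bigcap_(j in [set j | j \in [set: I]%SET]) (X j @^-1` (if j == i then A else C)).
Proof.
apply/seteqP; split => [w [Aw Cw] j _ /=|w Hw].
  by have [->|/Cw] := eqVneq j i.
split=> [|j ji].
  by have := Hw i; rewrite /= eqxx; apply; rewrite finset.in_setT.
by have := Hw j; rewrite /= (negbTE ji); apply; rewrite finset.in_setT.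
Qed.

Lemma measurable_one_and_others i A C :
  measurable A -> measurable C -> measurable (one_and_others i A C).
Proof.
move=> mA mC; rewrite one_and_othersE.
apply: fin_bigcap_measurable; first exact: finite_finset.
by move=> j _; apply: measurable_funPTI; case: ifP.
Qed.

Hypothesis X_iid : iid_std_gaussian X.

Lemma iid_law i A : measurable A -> P (X i @^-1` A) = normal_prob 0 1 A.
Proof. by move=> mA; have [_ /(_ i A mA) <-] := X_iid. Qed.

Lemma prob_one_and_others i A C : measurable A -> measurable C ->
  P (one_and_others i A C) =
  (normal_prob 0 1 A * \prod_(j | j != i) normal_prob 0 1 C)%E.
Proof.
move=> mA mC; have [indep _] := X_iid; rewrite one_and_othersE.
have mAC j : measurable (if j == i then A else C) by case: ifP.
rewrite (indep finset.setT (fun j => if j == i then A else C))//.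
rewrite (bigD1 i) ?finset.in_setT//= eqxx iid_law//; congr (_ * _)%E.
apply: eq_big => [j|j /andP[_ ji]]; first by rewrite finset.in_setT.
by rewrite (negbTE ji) iid_law.
Qed.

Lemma prob_all C : measurable C ->
  P [set w | forall i, C (X i w)] = (\prod_(i : I) normal_prob 0 1 C)%E.
Proof.
move=> mC; have [indep _] := X_iid.
have -> : [set w | forall i, C (X i w)] =
    \bigcap_(i in [set i | i \in [set: I]%SET]) (X i @^-1` C).
  apply/seteqP; split => [w Cw i _ //|w Cw i].
  by apply: (Cw i); rewrite /= finset.in_setT.
rewrite (indep finset.setT (fun=> C))//.
apply: eq_big => [j|j _]; first by rewrite finset.in_setT.
exact: iid_law.
Qed.

Lemma le_prob_one_and_others (r : R) i A A' C : 0 <= r ->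
  measurable A -> measurable A' -> measurable C ->
  (normal_prob 0 1 A <= r%:E * normal_prob 0 1 A')%E ->
  (P (one_and_others i A C) <= r%:E * P (one_and_others i A' C))%E.
Proof.
move=> r0 mA mA' mC AA'; rewrite !prob_one_and_others// muleA.
apply: lee_wpmul2r => //; apply: prode_ge0 => j _.
exact: (@measure_ge0 _ _ _ (normal_prob 0 1)).
Qed.

(** Each [w] in [S] with a value at most [- s - 2 * h] falls into some [E m i],
    where [i] indexes the minimum and [m] its cell, at distance at least
    [(m + 2) * h] below the level [- s].  Exchanging the cell of [X i] for the one two steps higher turns
    [E m i] into [F m i], at the cost of the factor [expR (- (s * h))].  In
    [F m i] the value of [X i] is still the strict minimum, so [i] and [m] are
    determined by the sample and these events are disjoint.  The first term
    accounts for the samples without a value at or below [- s - 2 * h]. *)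
Lemma prob_min_isolated_le (s h : R) (S : set T) : 0 <= s -> 0 < h ->
  measurable S ->
  (forall w, S w -> exists i, forall j, j != i -> X i w + 3 * h <= X j w) ->
  (P S <= P [set w | forall i, (- s - 2 * h < X i w)%R] + (expR (- (s * h)))%:E)%E.
Proof.
move=> s0 h0 mS gapS.
pose t m : R := - s - m%:R * h.
pose E m i := one_and_others i `]t m - 3 * h, t m - 2 * h] `]t m, +oo[.
pose F m i := one_and_others i `]t m - h, t m] `]t m, +oo[.
pose tail := [set w | forall i, `]- s - 2 * h, +oo[%classic (X i w)].
have mE m i : measurable (E m i) by apply: measurable_one_and_others.
have mF m i : measurable (F m i) by apply: measurable_one_and_others.
have mUE m : measurable (\bigcup_(i in [set: I]) E m i).
  by apply: fin_bigcup_measurable => //; exact: finite_finset.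
have mUF m : measurable (\bigcup_(i in [set: I]) F m i).
  by apply: fin_bigcup_measurable => //; exact: finite_finset.
have mtail : measurable tail.
  have -> : tail = \bigcap_(i in [set: I]) (X i @^-1` `]- s - 2 * h, +oo[).
    by apply/seteqP; split => [w tw i _|w tw i]; apply: tw.
  apply: fin_bigcap_measurable => [|i _]; first exact: finite_finset.
  exact: measurable_funPTI.
have -> : [set w | forall i, - s - 2 * h < X i w] = tail.
  by apply/seteqP; split => w tw i; have := tw i; rewrite /= in_itv/= andbT.
have sub : S `<=` tail `|` \bigcup_m \bigcup_(i in [set: I]) E m i.
  move=> w /gapS[i gapi].
  have [lt_i|ge_i] := ltP (- s - 2 * h) (X i w).
    left => j /=; rewrite in_itv/= andbT.
    have [->//|/gapi] := eqVneq j i; nra.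
  right; pose u := (- s - 2 * h - X i w) / h.
  have u0 : 0 <= u by apply: divr_ge0; rewrite ?subr_ge0// ltW.
  have hu : u * h = - s - 2 * h - X i w by rewrite divfK// gt_eqF.
  exists (Num.truncn u) => //; exists i => //.
  have /andP[lo hi] := truncn_itv u0; rewrite -natr1 in hi.
  have hlo : (Num.truncn u)%:R * h <= u * h by rewrite ler_pM2r.
  have hhi : u * h < ((Num.truncn u)%:R + 1) * h by rewrite ltr_pM2r.
  rewrite hu ?mulrDl ?mul1r in hlo hhi.
  split=> [|j /gapi Xj] /=; rewrite /t in_itv/=; last by rewrite andbT; lra.
  by apply/andP; split; lra.
have PE m : (P (\bigcup_(i in [set: I]) E m i) <=
    (expR (- (s * h)))%:E * P (\bigcup_(i in [set: I]) F m i))%E.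
  rewrite [X in (_ <= _ * X)%E]measure_fin_bigcup//; last first.
  - move=> i j _ _ [w [[Xi _] [_ oj]]]; move: Xi => /=.
    rewrite in_itv/= => /andP[_ Xi].
    apply/eqP/negPn/negP => ij.
    by have := oj i ij; rewrite /= in_itv/= andbT ltNge Xi.
  - exact: finite_finset.
  rewrite ge0_mule_fsumr//.
  apply: (@le_trans _ _ (\sum_(i \in [set: I]) P (E m i))%E).
    by apply: content_sub_fsum => //; exact: finite_finset.
  apply: lee_fsum => [|i _]; first exact: finite_finset.
  apply: le_prob_one_and_others => //.
  apply: normal_prob_cell_ratio => //.
  by rewrite /t lerBlDr lerDl mulr_ge0// ltW.
apply: (@le_trans _ _ (P (tail `|` \bigcup_m \bigcup_(i in [set: I]) E m i))).
  apply: le_measure => //; rewrite inE//.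
  by apply: measurableU => //; exact: bigcup_measurable.
apply: le_trans (measureU2 _ _ _) _ => //; first exact: bigcup_measurable.
apply: leeD2l.
apply: (@le_trans _ _ (\big[+%E/0]_(0 <= m <oo)
    ((expR (- (s * h)))%:E * P (\bigcup_(i in [set: I]) F m i)))%E).
  apply: (@le_trans _ _
      (\big[+%E/0]_(0 <= m <oo) P (\bigcup_(i in [set: I]) E m i))%E).
    by apply: measure_sigma_subadditive => //; exact: bigcup_measurable.
  exact: lee_nneseries.
rewrite nneseriesZl//.
rewrite -[leRHS]mule1; apply: lee_wpmul2l; first by rewrite lee_fin expR_ge0.
rewrite -measure_semi_bigcup//.
- apply: probability_le1; exact: bigcup_measurable.
- move=> m n _ _ [w [[i _ [+ oi]] [j _ [+ oj]]]].
  rewrite /= !in_itv/= => /andP[lo hi] /andP[lo' hi'].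
  have [ij|ij] := eqVneq i j; last first.
    have := oj i ij; rewrite /= in_itv/= andbT => ji.
    have := oi j; rewrite eq_sym => /(_ ij); rewrite /= in_itv/= andbT => ij'.
    by have := lt_le_trans ij' hi'; rewrite ltNge (ltW (lt_le_trans ji hi)).
  subst j; rewrite /t in lo hi lo' hi'.
  have {lo hi'} : n%:R * h < (m%:R + 1) * h by lra.
  have {lo' hi} : m%:R * h < (n%:R + 1) * h by lra.
  rewrite !ltr_pM2r// !natr1 !ltr_nat !ltnS => mn nm.
  by apply/eqP; rewrite eqn_leq mn nm.
- exact: bigcup_measurable.
Qed.

End Independence.

Lemma prob_all_gt_le (R : realType) (d : measure_display) (T : measurableType d)
    (P : probability T R) (I : finType) (X : I -> {RV P >-> R}) (c : R) :
  iid_std_gaussian X -> 0 <= c ->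
  (P [set w | forall i, (- c < X i w)%R] <=
   (expR (- (#|I|%:R * normal_pdf 0 1 (- c - 1))))%:E)%E.
Proof.
move=> X_iid c0.
have -> : [set w | forall i, (- c < X i w)%R] =
    [set w | forall i, `]- c, +oo[%classic (X i w)].
  by apply/seteqP; split => w tw i; have := tw i; rewrite /= in_itv/= andbT.
have mI : measurable (`]- c, +oo[%classic : set R) by exact: measurable_itv.
have /fineK qE := fin_num_measure (normal_prob 0 1) _ mI.
rewrite (prob_all X_iid)// (eq_bigr (fun=> (fine _)%:E) (fun _ _ => esym qE)).
rewrite prodEFin prodr_const lee_fin -mulrN expRM_natl.
apply: lerXn2r; rewrite ?nnegrE ?expR_ge0 -?lee_fin ?qE//.
exact: normal_prob_gt_le.
Qed.

(** * The mass of the minimum *)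

Section Ranks.
Variables (R : realType) (N : nat).
Implicit Types (x : 'I_(2 ^ N) -> R) (k l : 'I_(2 ^ N)).

Lemma rank_index_inj x : injective (rank_index x).
Proof.
by apply/tuple_uniqP; rewrite /= sort_uniq enum_uniq.
Qed.

Lemma order_stat_mono x k l : (k <= l)%N -> order_stat x k <= order_stat x l.
Proof.
move=> kl; pose r : rel 'I_(2 ^ N) := fun i j => x i <= x j.
have r_tr : transitive r by move=> b a c; exact: le_trans.
have r_refl : reflexive r by move=> a; exact: lexx.
have r_tot : total r by move=> a b; exact: le_total.
have sz : size (sort r (ord_tuple (2 ^ N))) = (2 ^ N)%N.
  by rewrite size_sort size_tuple.
rewrite /order_stat /rank_index !(tnth_nth (first N)) /=.
by apply: (sorted_leq_nth r_tr r_refl (first N) (sort_sorted r_tot _));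
  rewrite ?inE ?sz.
Qed.

Definition second (N1 : (1 < 2 ^ N)%N) : 'I_(2 ^ N) := Ordinal N1.

(** Every index other than that of the minimum has positive rank, hence rank at
    least that of the second smallest value. *)
Lemma order_stat_second_le x (N1 : (1 < 2 ^ N)%N) j :
  j != rank_index x (first N) -> order_stat x (second N1) <= x j.
Proof.
have [f fK rK] := injF_bij (@rank_index_inj x).
rewrite -[j]rK (inj_eq (@rank_index_inj x)) => jn.
apply: order_stat_mono; rewrite /= lt0n; apply: contraNneq jn => j0.
by apply/eqP/val_inj.
Qed.

End Ranks.

Section MinimumMass.
Variables (R : realType) (N K : nat) (beta : R).
Variables (sigma : 'I_(2 ^ N) -> config N) (x : 'I_(2 ^ N) -> R).
Hypotheses (sigma_inj : injective sigma) (K_gt1 : (1 < K)%N).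

Definition trunc_partition : R :=
  \sum_(k < 2 ^ N | (k < K)%N) trunc_weight beta x k.

Definition min_mass : R :=
  trunc_gibbs K beta sigma x
    (fun s => (s == sorted_config sigma x (first N))%:R).

Lemma trunc_weight_gt0 k : 0 < trunc_weight beta x k.
Proof. exact: expR_gt0. Qed.

Lemma trunc_weight_first : trunc_weight beta x (first N) = 1.
Proof. by rewrite /trunc_weight subrr mulr0 oppr0 expR0. Qed.

Lemma min_massE : min_mass = trunc_partition^-1.
Proof.
rewrite /min_mass /trunc_gibbs -/trunc_partition (bigD1 (first N)) ?(ltnW K_gt1)//=.
rewrite eqxx mul1r trunc_weight_first big1 ?addr0 ?div1r// => k /andP[_ kn].
by rewrite (inj_eq sigma_inj) (inj_eq (@rank_index_inj _ _ x)) (negbTE kn) mul0r.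
Qed.

Lemma trunc_partition_ge (N1 : (1 < 2 ^ N)%N) :
  1 + trunc_weight beta x (second N1) <= trunc_partition.
Proof.
rewrite /trunc_partition (bigD1 (first N)) ?(ltnW K_gt1)//=.
rewrite trunc_weight_first lerD2l (bigD1 (second N1))/= ?K_gt1//.
by rewrite lerDl sumr_ge0// => k _; exact/ltW/trunc_weight_gt0.
Qed.

Lemma trunc_partition_gt1 (N1 : (1 < 2 ^ N)%N) : 1 < trunc_partition.
Proof.
by apply: lt_le_trans (trunc_partition_ge N1); rewrite ltrDl trunc_weight_gt0.
Qed.

Lemma min_mass_lt1 : (1 < 2 ^ N)%N -> min_mass < 1.
Proof.
move=> N1; have W1 := trunc_partition_gt1 N1.
by rewrite min_massE invf_lt1// (lt_trans ltr01).
Qed.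

(** This form avoids the inverse, which makes the measurability of the event
    immediate from that of the partition function. *)
Lemma min_mass_ge eps : (1 < 2 ^ N)%N ->
  (1 - eps <= min_mass) = ((1 - eps) * trunc_partition <= 1).
Proof.
move=> N1; have W1 := trunc_partition_gt1 N1.
by rewrite min_massE -[_^-1]mul1r ler_pdivlMr// (lt_trans ltr01).
Qed.

(** Since [1 + w <= trunc_partition], where [w] is the weight of the second
    smallest value, the hypothesis forces [w <= expR (- (beta * L))].  The slope
    in the exponent of [w] is [beta * Num.sqrt N%:R], because
    [2 * ln (2 ^+ N) = beta_c R ^+ 2 * N%:R]. *)
Lemma gap_of_min_mass (L : R) : beta_c R < beta -> (1 < 2 ^ N)%N ->
  1 - expR (- (beta * L)) / (1 + expR (- (beta * L))) <= min_mass ->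
  exists i, forall j, j != i -> x i + L / Num.sqrt N%:R <= x j.
Proof.
move=> beta_gt N1 heavy.
have ln2 : 0 < 2 * ln 2 :> R by rewrite mulr_gt0// ln_gt0// ltr1n.
have bc0 : 0 < beta_c R by rewrite sqrtr_gt0.
have beta0 : 0 < beta by exact: lt_trans beta_gt.
have N0 : (0 < N)%N by case: (N) N1.
have sN0 : 0 < Num.sqrt N%:R :> R by rewrite sqrtr_gt0 ltr0n.
have slope : beta / beta_c R * Num.sqrt (2 * ln (2 ^+ N)) = beta * Num.sqrt N%:R.
  have -> : 2 * ln (2 ^+ N) = 2 * ln 2 * N%:R :> R.
    by rewrite lnXn// -[ln 2 *+ N]mulr_natr mulrA.
  rewrite sqrtrM ?(ltW ln2)// -/(beta_c R) mulrA divfK// gt_eqF//.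
set delta := expR _ in heavy.
have delta0 : 0 < delta by exact: expR_gt0.
move: heavy; rewrite min_mass_ge//.
have -> : 1 - delta / (1 + delta) = (1 + delta)^-1 by field; lra.
rewrite mulrC ler_pdivrMr ?mul1r; last by lra.
move/(le_trans (trunc_partition_ge N1)); rewrite lerD2l.
rewrite /trunc_weight slope ler_expR lerN2 -mulrA ler_pM2l// => gap.
exists (rank_index x (first N)) => j jn.
rewrite -lerBrDl ler_pdivrMr// mulrC (le_trans gap)// ler_pM2l// lerB//.
exact: order_stat_second_le.
Qed.

End MinimumMass.

Section Measurability.
Variables (R : realType) (d : measure_display) (T : measurableType d).
Variables (P : probability T R) (N : nat) (X : 'I_(2 ^ N) -> {RV P >-> R}).

(** The sorting permutation depends on the sample only through the finitely many
    comparisons [X i w <= X j w].  On each of the events that fix all of them,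
    the order statistic is a single variable [X i]. *)
Lemma measurable_order_stat k :
  measurable_fun [set: T] (fun w => order_stat (fun i => X i w) k).
Proof.
pose pat w : {ffun 'I_(2 ^ N) * 'I_(2 ^ N) -> bool} :=
  [ffun p => X p.1 w <= X p.2 w].
pose idx (m : {ffun 'I_(2 ^ N) * 'I_(2 ^ N) -> bool}) :=
  tnth [tuple of sort (fun i j => m (i, j)) (ord_tuple (2 ^ N))] k.
have idxE w : rank_index (fun i => X i w) k = idx (pat w).
  rewrite /rank_index /idx !(tnth_nth (first N)) /=; congr nth.
  by congr sort; apply/funext => i; apply/funext => j; rewrite ffunE.
have mpat m : measurable [set w | pat w = m].
  have -> : [set w | pat w = m] = \bigcap_(p in setT)
      ((fun w => X p.1 w <= X p.2 w) @^-1` [set m p]).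
    apply/seteqP; split => [w <- p _ /=|w Hw]; first by rewrite ffunE.
    by apply/ffunP => p; rewrite ffunE; exact: Hw.
  apply: fin_bigcap_measurable => [|p _]; first exact: finite_finset.
  rewrite -[X in measurable X]setTI.
  by apply: measurable_fun_ler.
move=> _ Y mY; rewrite setTI.
have -> : (fun w => order_stat (fun i => X i w) k) @^-1` Y =
    \bigcup_(m in setT) ([set w | pat w = m] `&` X (idx m) @^-1` Y).
  apply/seteqP; split => [w Yw|w [m _ [/= <-]]].
    by exists (pat w) => //; split => //=; rewrite -idxE.
  by rewrite /= -idxE.
apply: fin_bigcup_measurable => [|m _]; first exact: finite_finset.
by apply: measurableI => //; exact: measurable_funPTI.
Qed.

Lemma measurable_trunc_partition K beta :
  measurable_fun [set: T] (fun w => trunc_partition K beta (fun i => X i w)).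
Proof.
rewrite /trunc_partition.
under eq_fun do rewrite big_mkcond.
apply: measurable_sum => k; case: (k < K)%N => //.
rewrite /trunc_weight; under eq_fun do rewrite -mulNr.
apply: (measurableT_comp (@measurable_expR R)).
by apply: measurable_funM => //; apply: measurable_funB; exact: measurable_order_stat.
Qed.

Lemma measurable_heavy_min K beta (sigma : 'I_(2 ^ N) -> config N) eps :
  injective sigma -> (1 < K)%N -> (1 < 2 ^ N)%N ->
  measurable [set w | 1 - eps <= min_mass K beta sigma (fun i => X i w)].
Proof.
move=> sigma_inj K1 N1.
under eq_set do rewrite min_mass_ge//.
rewrite -[X in measurable X]setTI.
apply: measurable_fun_le => //.
by apply: measurable_funM => //; exact: measurable_trunc_partition.
Qed.

End Measurability.

(** * Non-concentration on the minimum *)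

Theorem mainTheorem7 (R : realType) (d : measure_display)
  (T : measurableType d) (P : probability T R)
  (sigma : forall N : nat, 'I_(2 ^ N) -> config N)
  (sigma_bij : forall N : nat, bijective (sigma N))
  (X : forall N : nat, 'I_(2 ^ N) -> {RV P >-> R})
  (X_iid : forall N : nat, iid_std_gaussian (X N))
  (kN : nat -> nat)
  (kN_incr : \forall N \near \oo, (kN N <= kN N.+1)%N)
  (kN_infty : kN N @[N --> \oo] --> \oo)
  (kN_ratio_incr : \forall N \near \oo,
     (kN N)%:R / N%:R <= (kN N.+1)%:R / N.+1%:R :> R)
  (kN_ratio_infty : ((kN N)%:R / N%:R : R) @[N --> \oo] --> +oo)
  (kN_log_decr : \forall N \near \oo,
     ln (kN N.+1)%:R * ln N.+1%:R / N.+1%:R <=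
     ln (kN N)%:R * ln N%:R / N%:R :> R)
  (kN_log_0 : (ln (kN N)%:R * ln N%:R / N%:R : R) @[N --> \oo] --> (0 : R))
  (beta : R) (beta_gt : beta_c R < beta) :
  (* for all large N, almost surely the truncated Gibbs measure is not the
     point mass at the minimum *)
  (\forall N \near \oo, {ae P, forall w : T,
     trunc_gibbs (kN N) beta (sigma N) (fun i => X N i w) <>
     point_mass (sorted_config (sigma N) (fun i => X N i w) (first N))})
  /\
  (* nor does it concentrate there as N tends to infinity: the mass of the
     minimum stays away from 1 in probability *)
  (forall eta : R, 0 < eta -> exists2 eps : R, 0 < eps &
     \forall N \near \oo,
       (P [set w | (1 - eps <=
             trunc_gibbs (kN N) beta (sigma N) (fun i => X N i w)
               (fun s => (s == sorted_config (sigma N)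
                                 (fun i => X N i w) (first N))%:R))%R]
        <= eta%:E)%E).
Proof.
have kN_gt1 : \forall N \near \oo, (1 < kN N)%N.
  exact: kN_infty _ (nbhs_infty_ge 2).
have sigma_inj N : injective (sigma N) by exact: bij_inj.
have pow_gt1 N : (0 < N)%N -> (1 < 2 ^ N)%N by move=> N0; rewrite -(expn0 2) ltn_exp2l.
split.
  near=> N; apply: aeW => w /(congr1 (fun mu => mu (fun s =>
    (s == sorted_config (sigma N) (fun i => X N i w) (first N))%:R))).
  rewrite /point_mass eqxx => mass1.
  have := @min_mass_lt1 R N (kN N) beta (sigma N) (fun i => X N i w) (sigma_inj N).
  rewrite /min_mass mass1 ltxx => /(_ _ _)/notF; apply; first by near: N.
  by apply: pow_gt1; near: N; exact: nbhs_infty_gt.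
move=> eta eta0.
(* Both error terms are made at most [eta / 2]: [L / 2] exceeds [b], and
   [expR (- b) <= eta / 2]. *)
pose b := `|ln (eta / 2)|; pose L := 1 + 2 * b.
have b0 : 0 <= b by exact: normr_ge0.
have exp_le r : b <= r -> expR (- r) <= eta / 2.
  move=> br; rewrite -[leRHS]lnK ?posrE ?divr_gt0// ler_expR.
  by rewrite lerNl (le_trans _ br)// /b -normrN ler_norm.
(* The gap has to exceed three cells of length [L / Num.sqrt N%:R]. *)
pose delta := expR (- (beta * (3 * L))).
have delta0 : 0 < delta by exact: expR_gt0.
exists (delta / (1 + delta)); first by rewrite divr_gt0// addr_gt0.
near=> N.
have N1 : (1 < 2 ^ N)%N by apply: pow_gt1; near: N; exact: nbhs_infty_gt.
have K1 : (1 < kN N)%N by near: N.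
pose r : R := Num.sqrt N%:R.
have r2 : r ^+ 2 = N%:R by rewrite sqr_sqrtr.
have r_ge : 2 * L <= r.
  rewrite -[leLHS]ger0_norm ?mulr_ge0 ?addr_ge0 ?mulr_ge0// -sqrtr_sqr ler_wsqrtr//.
  by near: N; exact: nbhs_infty_ger.
have r0 : 0 < r by rewrite /L in r_ge; lra.
have peak0 : 0 < normal_peak (1 : R) by rewrite normal_peak_gt0 ?oner_neq0.
have h0 : 0 < L / r by rewrite divr_gt0// /L; lra.
apply: le_trans (@prob_min_isolated_le R d T P _ (X N) (X_iid N) (r / 2) (L / r)
  _ _ h0 _ _) _.
- by rewrite divr_ge0// ltW.
- exact: (@measurable_heavy_min R d T P N (X N) (kN N) beta (sigma N)).
- move=> w /(@gap_of_min_mass R N (kN N) beta (sigma N) _ (sigma_inj N) K1 (3 * L)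
    beta_gt N1).
  by rewrite mulrA.
(* Left: no value near or below [- r / 2]; right: an isolated minimum. *)
rewrite [eta]splitr EFinD; apply: leeD; last first.
  rewrite lee_fin; apply: exp_le.
  have -> : r / 2 * (L / r) = L / 2 by field; rewrite gt_eqF.
  by rewrite /L; lra.
(* The shift of the level by two cells is absorbed by the constant 2 in the
   lemma on the density at [- (r / 2 + 2)]. *)
have hr : 2 * (L / r) <= 1 by rewrite mulrA ler_pdivrMr// mul1r.
have -> : - (r / 2) - 2 * (L / r) = - (r / 2 + 2 * (L / r)) by ring.
apply: le_trans (prob_all_gt_le (X_iid N) _) _; first by lra.
rewrite lee_fin; apply: exp_le; rewrite card_ord.
apply: (@le_trans _ _ ((2 ^ N)%:R * normal_pdf 0 1 (- (r / 2 + 2)))); last first.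
  by apply: ler_wpM2l => //; apply: normal_pdf_nondecreasing_neg; lra.
apply: le_trans (normal_pdf_level_ge R N).
rewrite mulrC -ler_pdivrMr// lerBrDr ler_pdivlMr//.
by near: N; exact: nbhs_infty_ger.
Unshelve. all: by end_near.
Qed.
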